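(* Let $N(\cdot)$ be a counting process with counting times $0=t_0<t_1<\cdots$, inter-arrival times $T_n=t_n-t_{n-1}$, residual time process $R(\cdot)$ and $X(t)=(N(t),R(t))$, and let $\mathbb{F}=\{\mathcal{F}_t;t\ge0\}$ be a filtration such that $\sigma(\{X(u);u\le t\})\subset\mathcal{F}_t$ for all $t\ge0$. Assume that $X(0)=(1,T_1)$ (i.e. $t_0=0$), that $T_n>0$ almost surely and $\mathbb{E}[T_n]<\infty$ for all $n\ge1$, and that $\mathbb{E}[N(t)]<\infty$ for all finite $t\ge0$. For $v>0$ put $T^{(v)}_n=T_n\wedge v$, $R^{(v)}(t)=R(t)\wedge v$, and $$\widetilde\lambda^{(v)}(t)=\frac1{\mathbb{E}[T^{(v)}_n\mid\mathcal{F}_{t_{n-1}-}]},\qquad t\in[t_{n-1},t_n),\ n=1,2,\ldots.$$ Suppose that there exists $v>0$ such that, as $t\to\infty$, both $\mathbb{E}\big[\widetilde\lambda^{(v)}(t)\,1(R(t)\le v)\big]$ and $\mathbb{E}\big[\widetilde\lambda^{(v)}(t)\,R^{(v)}(t)\big]$ converge to finite positive limits. Then there exists $\lambda>0$ such that $$\lim_{t\to\infty}\frac{\mathbb{E}[N(t)]}{t}=\lambda$$ and, for every $0<h<\infty$, $$\lim_{t\to\infty}\big(\mathbb{E}[N(t+h)]-\mathbb{E}[N(t)]\big)=\lambda h.$$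
   Context: A counting process $N(\cdot)=\{N(t);t\ge0\}$ is a non-negative integer-valued process such that $N(t)$ is finite, nondecreasing and right-continuous with left-hand limits, and $N(t)-N(t-)\le1$ for all $t\ge0$, where $N(0-)=0$. Its counting times are $t_{n-1}=\inf\{t\ge0;\,n\le N(t)\}$, $n\ge1$. Since $t_0=0$, we have $N(0)=1$, and $n\le N(t)$ if and only if $t_{n-1}\le t$. For $n\ge1$, $T_n=t_n-t_{n-1}$. The residual time to the next counting instant is $R(t)=\sum_{\ell=1}^{N(t)}T_\ell-t$ for $t\ge0$ (so $R(t)=t_n-t$ for $t_{n-1}\le t<t_n$, and $R(t_n)=T_{n+1}$). For an $\mathbb{F}$-stopping time $\tau$, $\mathcal{F}_{\tau-}=\sigma(\{A\cap\{t<\tau\};A\in\mathcal{F}_t,t\ge0\})$; in particular $\mathcal{F}_{t_0-}$ is trivial when $t_0=0$. Each $t_n$ is an $\mathbb{F}$-stopping time. $1(\cdot)$ is the indicator function and $a\wedge b=\min(a,b)$. *)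

(* Defs.v *)
From HB Require Import structures.
From mathcomp Require Import all_boot all_order all_algebra.
From mathcomp Require Import all_classical all_reals all_analysis.
From mathcomp Require Import measurable_realfun.
Export numFieldNormedType.Exports.

Set Implicit Arguments.
Unset Strict Implicit.
Unset Printing Implicit Defensive.

Import Order.TTheory GRing.Theory Num.Theory.

Local Open Scope classical_set_scope.
Local Open Scope ring_scope.

(* Processes are indexed by all of R, but only their values at times t >= 0 are
   ever constrained or used. *)

Section counting_process.
Context {R : realType} {Omega : Type} (N : R -> Omega -> nat).

(* N(t-), with N(0-) = 0 *)
Definition left_value (t : R) (w : Omega) : R :=
  if t == 0 then 0 else lim (((N s w)%:R : R) @[s --> t^'-]).

Definition counting_path (w : Omega) : Prop :=
  [/\ forall s t, 0 <= s -> s <= t -> (N s w <= N t w)%N,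
      forall t, 0 <= t -> ((N s w)%:R : R) @[s --> t^'+] --> ((N t w)%:R : R),
      forall t, 0 < t -> cvg (((N s w)%:R : R) @[s --> t^'-])
    & forall t, 0 <= t -> (N t w)%:R - left_value t w <= 1].

(* [counting_time n] is t_n = inf {t >= 0 : n + 1 <= N(t)}; it takes values in
   the extended reals, the infimum of the empty set being +oo. *)
Definition counting_time (n : nat) (w : Omega) : \bar R :=
  ereal_inf [set t%:E | t in [set t : R | 0 <= t /\ (n.+1 <= N t w)%N]].

(* T_n = t_n - t_(n-1), meaningful for n >= 1 only *)
Definition interarrival (n : nat) (w : Omega) : \bar R :=
  (counting_time n w - counting_time n.-1 w)%E.

Definition residual (t : R) (w : Omega) : \bar R :=
  (\sum_(1 <= l < (N t w).+1) interarrival l w - t%:E)%E.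

Definition counting_state (t : R) (w : Omega) : nat * \bar R :=
  (N t w, residual t w).

Definition trunc_interarrival (v : R) (n : nat) (w : Omega) : \bar R :=
  mine (interarrival n w) v%:E.

Definition trunc_residual (v t : R) (w : Omega) : \bar R :=
  mine (residual t w) v%:E.

End counting_process.

Definition counting_process {d} {Omega : measurableType d} {R : realType}
    (N : R -> Omega -> nat) : Prop :=
  (forall t, 0 <= t -> measurable_fun [set: Omega] (N t)) /\
  (forall w, counting_path N w).

Definition filtration {d} {Omega : measurableType d} {R : realType}
    (F : R -> set_system Omega) : Prop :=
  [/\ forall t, 0 <= t -> sigma_algebra [set: Omega] (F t),
      forall t, 0 <= t -> F t `<=` measurable
    & forall s t, 0 <= s -> s <= t -> F s `<=` F t].

(* sigma(X(u); 0 <= u <= t) *)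
Definition natural_sigma {Omega : Type} {d'} {S : measurableType d'}
    {R : realType} (X : R -> Omega -> S) (t : R) : set_system Omega :=
  <<s [set A | exists u B,
        [/\ 0 <= u, u <= t, measurable B & A = X u @^-1` B] ]>>.

(* F_(tau-), for tau with values in [0, +oo] *)
Definition sigma_strict_past {Omega : Type} {R : realType}
    (F : R -> set_system Omega) (tau : Omega -> \bar R) : set_system Omega :=
  <<s [set B | exists t A,
        [/\ 0 <= t, F t A & B = A `&` [set w | (t%:E < tau w)%E] ] ]>>.

(* Y is a (finite) version of E[X | G]. *)
Definition is_condexp {d} {Omega : measurableType d} {R : realType}
    (P : probability Omega R) (G : set_system Omega)
    (X : Omega -> \bar R) (Y : Omega -> R) : Prop :=
  [/\ forall B : set R, measurable B -> G (Y @^-1` B),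
      P.-integrable [set: Omega] (EFin \o Y)
    & forall A, G A -> (\int[P]_(w in A) (Y w)%:E = \int[P]_(w in A) X w)%E].

(* lam(t) = 1 / E[T_n /\ v | F_(t_(n-1)-)] on [t_(n-1), t_n), for some version
   of each conditional expectation; the inverse of 0 is 0, which matters only
   on a null set when T_n > 0 almost surely. *)
Definition is_trunc_intensity {d} {Omega : measurableType d} {R : realType}
    (P : probability Omega R) (F : R -> set_system Omega)
    (N : R -> Omega -> nat) (v : R) (lam : R -> Omega -> R) : Prop :=
  exists C : nat -> Omega -> R,
    (forall n, (0 < n)%N ->
      is_condexp P (sigma_strict_past F (counting_time N n.-1))
        (trunc_interarrival N v n) (C n)) /\
    (forall n t w, (0 < n)%N ->
      (counting_time N n.-1 w <= t%:E)%E -> (t%:E < counting_time N n w)%E ->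
      lam t w = (C n w)^-1).

(* Main.v *)
(** Write [C_n] for [E[T_n /\ v | F_(t_(n-1)-)]].  On [[t_(n-1), t_n)] the process
    [lam * (R /\ v)] starts at [(T_n /\ v) / C_n], whose conditional expectation is
    1, and decreases at rate [lam * 1(R <= v)].  Since [{t_(n-1) <= t}] belongs to
    [F_(t_(n-1)-)], taking expectations and summing over [n] gives the identity
    [E[N(t)] = \int_0^t E[lam(u) 1(R(u) <= v)] du + E[lam(t) (R(t) /\ v)]].
    As the integrand tends to [a] and the last term converges, [E[N(t)]] has
    increments asymptotic to those of [a t]. *)
Require Import Defs.
From HB Require Import structures.
From mathcomp Require Import all_boot all_order all_algebra.
From mathcomp Require Import all_classical all_reals all_analysis.
From mathcomp Require Import measurable_realfun.
From mathcomp Require Import ring lra.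
Import Order.TTheory GRing.Theory Num.Theory.
Local Open Scope classical_set_scope.
Local Open Scope ring_scope.

Set Implicit Arguments.
Unset Strict Implicit.
Unset Printing Implicit Defensive.

(** * Paths of a counting process *)

Lemma counting_time_ge0 (R : realType) (Omega : Type) (N : R -> Omega -> nat)
    (w : Omega) (n : nat) :
  (0 <= counting_time N n w)%E.
Proof. by apply: le_ereal_inf_tmp => _ [t [t0 _] <-]; rewrite lee_fin. Qed.

(** Right-continuity makes the infimum attained: if [N t w <= n], the integer-valued path stays at
    most [n] on some [[t, t + d)], so the counting time is at least [t + d]. *)
Lemma counting_time_le (R : realType) (Omega : Type) (N : R -> Omega -> nat)
    (w : Omega) (n : nat) (t : R) :
  counting_path N w -> 0 <= t ->
  (counting_time N n w <= t%:E)%E = (n < N t w)%N.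
Proof.
move=> [mono rcont _ _] t0; apply/idP/idP; last first.
  by move=> nN; apply: ereal_inf_lbound; exists t.
apply: contraTT; rewrite -leqNgt -ltNge => Nn.
(* Radius 1 suffices, because natural numbers at distance less than 1 are equal. *)
have /(@cvgrPdist_lt _ R^o) /(_ 1 ltr01) [d /= d0 near_t] := rcont t t0.
have jump s : 0 <= s -> (n < N s w)%N -> t + d <= s.
  move=> s0 ns; rewrite leNgt; apply/negP => std.
  have ts : t < s.
    rewrite ltNge; apply/negP => st.
    by have := leq_trans ns (leq_trans (mono s t s0 st) Nn); rewrite ltnn.
  have : `|(N t w)%:R - (N s w)%:R| < 1 :> R.
    apply: near_t => //=.
    by rewrite distrC ger0_norm ?subr_ge0 ?(ltW ts)// ltrBlDl.
  have Nts : (N t w < N s w)%N by exact: leq_ltn_trans ns.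
  rewrite distrC -natrB ?(ltnW Nts)// ger0_norm// ltrn1.
  by rewrite ltnS leqn0 subn_eq0 leqNgt Nts.
apply: (@lt_le_trans _ _ (t + d)%:E); first by rewrite lte_fin ltrDl.
by apply: le_ereal_inf_tmp => _ [s [s0 ns] <-]; rewrite lee_fin jump.
Qed.

Lemma counting_time_leS (R : realType) (Omega : Type) (N : R -> Omega -> nat)
    (w : Omega) (n : nat) :
  (counting_time N n w <= counting_time N n.+1 w)%E.
Proof.
apply: le_ereal_inf_tmp => _ [t [t0 nN] <-].
by apply: ereal_inf_lbound; exists t => //; split => //; exact: ltnW.
Qed.

Lemma counting_eq (R : realType) (Omega : Type) (N : R -> Omega -> nat)
    (w : Omega) (n : nat) (t : R) :
  counting_path N w -> 0 <= t ->
  (N t w == n.+1) =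
  (counting_time N n w <= t%:E)%E && (t%:E < counting_time N n.+1 w)%E.
Proof.
move=> cN t0; rewrite ltNge !counting_time_le// -leqNgt eqn_leq andbC.
by [].
Qed.

(** The sum telescopes, and [N 0 w = 1] gives [t_0 = 0]. Only the last counting time can be
    infinite. *)
Lemma residualE (R : realType) (Omega : Type) (N : R -> Omega -> nat)
    (w : Omega) (t : R) :
  counting_path N w -> N 0 w = 1%N -> 0 <= t ->
  residual N t w = (counting_time N (N t w) w - t%:E)%E.
Proof.
move=> cN N0 t0; rewrite /residual; congr (_ - _)%E.
have tau0 : counting_time N 0 w = 0%E.
  apply/eqP; rewrite eq_le counting_time_ge0 andbT.
  by rewrite (@counting_time_le _ _ _ _ _ 0)// N0.
have : (N t w <= N t w)%N by [].
(* The bound by [N t w] is kept in the induction: it makes the counting times to be cancelled at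
   most [t], hence finite. *)
elim: {1 3 4}(N t w) => [_|n IHn nN]; first by rewrite big_geq.
rewrite big_nat_recr//= IHn ?(ltnW nN)//.
rewrite /interarrival /= addeC subeK// ge0_fin_numE ?counting_time_ge0//.
by apply: (@le_lt_trans _ _ t%:E); rewrite ?ltry// counting_time_le.
Qed.

(** For [x >= 0] the event [x < t_n] is [N x <= n]; for [x < 0] it is the whole space. *)
Lemma measurable_counting_time d (Omega : measurableType d) (R : realType)
    (N : R -> Omega -> nat) (n : nat) :
  counting_process N -> measurable_fun [set: Omega] (counting_time N n).
Proof.
move=> [mN cN].
apply: (measurability _ (ErealGenOInfty.measurableE R)) => // _ [_ [x ->] <-].
rewrite setTI preimage_itvoy.
have [x0|x0] := ltP x 0.
  rewrite [X in measurable X](_ : _ = setT)//; apply/seteqP; split=> // w _ /=.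
  by apply: (@lt_le_trans _ _ 0%E); rewrite ?lte_fin ?counting_time_ge0.
rewrite [X in measurable X](_ : _ = N x @^-1` [set k | (k <= n)%N]).
  by rewrite -[X in measurable X]setTI; exact: mN.
apply/seteqP; split=> w /=.
all: by rewrite ltNge counting_time_le// -leqNgt.
Qed.

(** * Conditional expectations *)

Section nnsfun_approximation.
Import HBNNSimple.

(* The right-hand side depends on [X] only through its integrals over the sets
   [A `&` f @^-1` B]. *)
Lemma ge0_integral_comp_lim d d' (T : measurableType d) (S : measurableType d')
    (R : realType) (mu : {measure set T -> \bar R}) (A : set T)
    (X : T -> R) (f : T -> S) (g : S -> R)
    (mg : measurable_fun [set: S] (EFin \o g)) :
  measurable A -> measurable_fun [set: T] X -> (forall x, 0 <= X x) ->
  measurable_fun [set: T] f -> (forall y, 0 <= g y) ->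
  (\int[mu]_(x in A) (g (f x) * X x)%:E =
   limn (fun k => \sum_(y \in range (nnsfun_approx measurableT mg k))
     (y%:E * \int[mu]_(x in A `&`
        (f @^-1` (nnsfun_approx measurableT mg k @^-1` [set y]))) (X x)%:E)))%E.
Proof.
move=> mA mX X0 mf g0; set h := nnsfun_approx measurableT mg.
have mhf k : measurable_fun [set: T] (fun x => h k (f x) : R).
  exact: measurableT_comp.
have mXA (Y : T -> R) : measurable_fun [set: T] Y ->
    measurable_fun A (fun x => (Y x * X x)%:E).
  move=> mY; apply/measurable_EFinP/measurable_funTS.
  exact: measurable_funM.
(* The simple approximations of [g] increase to it, so monotone convergence reduces the claim to
   simple weights. *)
transitivity (\int[mu]_(x in A) limn (fun k => (h k (f x) * X x)%:E))%E.
  apply: eq_integral => x _; apply/esym/cvg_lim => //; apply: cvg_EFin.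
    by apply: nearW.
  have : (EFin \o h ^~ (f x)) @ \oo --> (g (f x))%:E.
    by apply: (@cvg_nnsfun_approx _ _ _ _ measurableT _ mg) => // y _; rewrite lee_fin.
  move/fine_cvg => hg; apply: cvgM; last exact: cvg_cst.
  exact: hg.
rewrite monotone_convergence//; last 3 first.
- by move=> k; exact: mXA.
- by move=> k x _; rewrite lee_fin mulr_ge0.
- move=> x _ m n mn; rewrite lee_fin ler_wpM2r//.
  by have /lefP := nd_nnsfun_approx measurableT mg mn; exact.
congr (limn _); apply/funext => k.
have hkE x : (h k (f x))%:E = (\sum_(y \in range (h k))
    y%:E * (\1_(h k @^-1` [set y]) (f x))%:E)%E.
  by rewrite fsumEFin//= -fimfunE.
(* A simple weight is a finite combination of indicators of level sets, and each indicator moves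
   into the domain of integration. *)
transitivity (\int[mu]_(x in A) \sum_(y \in range (h k))
   ((y * \1_(h k @^-1` [set y]) (f x)) * X x)%:E)%E.
  apply: eq_integral => x _; rewrite EFinM hkE muleC ge0_mule_fsumr.
    by apply: eq_fsbigr => y _; rewrite EFinM muleC.
  by move=> y; exact: nnfun_muleindic_ge0.
rewrite ge0_integral_fsum//; last 2 first.
- move=> y; apply: mXA; apply: measurable_funM => //.
  by apply: measurableT_comp.
- move=> y x _; rewrite EFinM mule_ge0//; first exact: nnfun_muleindic_ge0.
  by rewrite lee_fin.
apply: eq_fsbigr => y; rewrite inE => -[z _ <-].
have mB : measurable (f @^-1` (h k @^-1` [set h k z])).
  rewrite -[X in measurable X]setTI; apply: mf => //.
rewrite integral_mkcondr -ge0_integralZl//; last 3 first.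
- apply/measurable_restrict => //; apply: measurable_funTS.
  exact/measurable_EFinP.
- by move=> x _; rewrite erestrict_ge0// => ? _; rewrite lee_fin.
- by rewrite lee_fin.
apply: eq_integral => x _.
rewrite epatch_indic/= -!EFinM !indicE -mulrA [in RHS](mulrC (X x)).
by congr (_ * (_ * _))%:E.
Qed.

(** This is the rule of taking out what is known, for nonnegative functions: a factor depending only
    on [f] may multiply both sides of the equality of integrals. *)
Lemma ge0_integral_comp_eq d d' (T : measurableType d) (S : measurableType d')
    (R : realType) (mu : {measure set T -> \bar R}) (A : set T)
    (X Y : T -> R) (f : T -> S) (g : S -> R) :
  measurable A ->
  measurable_fun [set: T] X -> (forall x, 0 <= X x) ->
  measurable_fun [set: T] Y -> (forall x, 0 <= Y x) ->
  measurable_fun [set: T] f ->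
  measurable_fun [set: S] g -> (forall y, 0 <= g y) ->
  (forall B, measurable B -> \int[mu]_(x in A `&` f @^-1` B) (X x)%:E =
     \int[mu]_(x in A `&` f @^-1` B) (Y x)%:E)%E ->
  (\int[mu]_(x in A) (g (f x) * X x)%:E =
   \int[mu]_(x in A) (g (f x) * Y x)%:E)%E.
Proof.
move=> mA mX X0 mY Y0 mf /measurable_EFinP mg g0 XY.
rewrite !(ge0_integral_comp_lim mu mg)//; congr (limn _); apply/funext => k.
by apply: eq_fsbigr => y _; rewrite XY.
Qed.

End nnsfun_approximation.

(** On [B = {C <= 0}], which lies in [G], the integral of [X] equals that of [C] and is thus at most
    0. As [X > 0] almost surely, [B] must be null. *)
Lemma condexp_gt0 d (Omega : measurableType d) (R : realType)
    (P : probability Omega R) (G : set_system Omega)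
    (X : Omega -> \bar R) (C : Omega -> R) :
  G `<=` measurable -> measurable_fun [set: Omega] X ->
  is_condexp P G X C -> {ae P, forall w, (0 < X w)%E} ->
  {ae P, forall w, 0 < C w}.
Proof.
move=> Gm mX [CG _ intC] X0.
pose B := C @^-1` `]-oo, 0%R].
have GB : G B by apply: CG.
have mB := Gm _ GB.
have mC : measurable_fun [set: Omega] C.
  by move=> _ Z mZ; rewrite setTI; exact/Gm/CG.
(* The positive part agrees with [X] almost surely and is nonnegative everywhere, so a zero integral
   forces it to vanish almost everywhere on [B]. *)
have mXp : measurable_fun [set: Omega] (fun w => maxe (X w) 0).
  exact: measurable_maxe.
have intXp : (\int[P]_(w in B) maxe (X w) 0 = \int[P]_(w in B) X w)%E.
  apply: ae_eq_integral => //; [exact: measurable_funTS..|].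
  by apply: filterS X0 => w Xw _; apply/max_idPl; exact: ltW.
have Xp0 : (\int[P]_(w in B) `|maxe (X w) 0| = 0)%E.
  under eq_integral => w _ do rewrite gee0_abs ?le_max ?lexx ?orbT//.
  apply/eqP; rewrite eq_le integral_ge0 ?andbT; last first.
    by move=> w _; rewrite le_max lexx orbT.
  rewrite intXp -intC//.
  under eq_integral => w _ do rewrite -[C w]opprK EFinN.
  have CN w : B w -> (0 <= (- C w)%:E)%E.
    by rewrite /B /= in_itv/= lee_fin oppr_ge0.
  by rewrite integral_ge0N// oppe_le0 integral_ge0.
have := (ae_eq_integral_abs P mB (measurable_funTS mXp)).1 Xp0.
apply: filterS2 X0 => w Xw XB; rewrite ltNge; apply/negP => Cw.
have := XB Cw => /= Xw0.
by move: Xw; rewrite ltNge -Xw0 le_max lexx.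
Qed.

(** Inversion is continuous on the open set of nonzero reals, and the remaining point is treated
    separately. *)
Lemma measurable_invr (R : realType) :
  measurable_fun [set: R] (@GRing.inv R).
Proof.
have -> : [set: R] = [set 0] `|` ~` [set 0] by rewrite setUv.
apply/measurable_funU => //; first exact: measurableC.
split; first exact: measurable_fun_set1.
apply: open_continuous_measurable_fun; first exact/closed_openC/closed_eq.
by move=> x; rewrite inE/= => /eqP; exact: inv_continuous.
Qed.

(* The [max]s only matter on a null set; they make both factors nonnegative
   everywhere. *)
Lemma condexp_inv d (Omega : measurableType d) (R : realType)
    (P : probability Omega R) (G : set_system Omega)
    (X : Omega -> \bar R) (C : Omega -> R) (v : R) (A : set Omega) :
  G `<=` measurable -> setI_closed G -> measurable_fun [set: Omega] X ->
  (forall w, (X w <= v%:E)%E) ->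
  is_condexp P G X C -> {ae P, forall w, (0 < X w)%E} -> G A ->
  (\int[P]_(w in A) (Num.max 0 (C w)^-1 * fine (maxe (X w) 0))%:E = P A)%E.
Proof.
move=> Gm GI mX Xv CX X0 GA; have C0 := condexp_gt0 Gm mX CX X0.
have [CG _ intC] := CX.
have mC : measurable_fun [set: Omega] C.
  by move=> _ Z mZ; rewrite setTI; exact/Gm/CG.
have mA := Gm _ GA.
have mXp : measurable_fun [set: Omega] (fun w => maxe (X w) 0).
  exact: measurable_maxe.
have Xpfin w : maxe (X w) 0 \is a fin_num.
  rewrite ge0_fin_numE ?le_max ?lexx ?orbT//.
  by rewrite gt_max ltry andbT (le_lt_trans (Xv w))// ltry.
have mg : measurable_fun [set: R] (fun y : R => Num.max 0 y^-1).
  by apply: measurable_maxr => //; exact: measurable_invr.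
have mCp : measurable_fun [set: Omega] (fun w => Num.max 0 (C w)).
  exact: measurable_maxr.
rewrite (@ge0_integral_comp_eq _ _ _ _ R P A
  (fun w => fine (maxe (X w) 0)) (fun w => Num.max 0 (C w)) C
  (fun y => Num.max 0 y^-1))//; last 5 first.
- exact: measurableT_comp.
- by move=> w; rewrite fine_ge0// le_max lexx orbT.
- by move=> w; rewrite le_max lexx.
- by move=> w; rewrite le_max lexx.
- move=> B mB; have GAB : G (A `&` C @^-1` B) by apply: GI => //; exact: CG.
  have mAB := Gm _ GAB.
  transitivity (\int[P]_(w in A `&` C @^-1` B) X w)%E.
    apply: ae_eq_integral => //; [|exact: measurable_funTS|].
      by apply/measurable_EFinP/measurable_funTS; exact: measurableT_comp.
    apply: filterS X0 => w Xw _; rewrite fineK//.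
    by apply/max_idPl; exact: ltW.
  rewrite -intC//.
  apply: ae_eq_integral => //; try exact/measurable_EFinP/measurable_funTS.
  by apply: filterS C0 => w Cw _; congr _%:E; apply/esym/max_idPr; exact: ltW.
(* The integrand is now [C^-1 * C], which is 1 wherever [C > 0]. *)
rewrite -[RHS]mul1e -integral_cst//.
apply: ae_eq_integral => //.
  apply/measurable_EFinP/measurable_funTS; apply: measurable_funM => //.
  exact: (measurableT_comp mg).
apply: filterS C0 => w Cw _ /=; congr _%:E.
by rewrite !max_r ?invr_ge0 ?ltW// mulVf// gt_eqF.
Qed.

Lemma sigma_strict_past_measurable d (Omega : measurableType d) (R : realType)
    (F : R -> set_system Omega) (tau : Omega -> \bar R) :
  filtration F -> measurable_fun [set: Omega] tau ->
  sigma_strict_past F tau `<=` measurable.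
Proof.
move=> [_ Fm _] mtau; apply: smallest_sub.
  exact: sigma_algebra_measurable.
move=> _ [t [A [t0 FA ->]]]; apply: measurableI; first exact: Fm FA.
by rewrite -[X in measurable X]setTI; exact: emeasurable_fun_o_infty.
Qed.

Lemma sigma_strict_past_setI (Omega : Type) (R : realType)
    (F : R -> set_system Omega) (tau : Omega -> \bar R) :
  setI_closed (sigma_strict_past F tau).
Proof.
have subT (X : set Omega) : sigma_strict_past F tau X -> X `<=` setT by [].
by have [_ _ _] := (sigma_algebraP subT).1 (smallest_sigma_algebra _ _).
Qed.

(** The complement is the generator obtained with [A] the whole space. Thus the event that an
    interval has begun by time [t] is known strictly before it begins. *)
Lemma sigma_strict_past_le d (Omega : measurableType d) (R : realType)
    (F : R -> set_system Omega) (tau : Omega -> \bar R) (t : R) :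
  filtration F -> 0 <= t ->
  sigma_strict_past F tau [set w | (tau w <= t%:E)%E].
Proof.
move=> [sF _ _] t0.
rewrite (_ : [set w | _] = setT `\` [set w | (t%:E < tau w)%E]).
  apply: sigma_algebraCD; apply: sub_sigma_algebra.
  exists t, setT; split => //.
    by have [F0 FC _] := sF t t0; rewrite -[setT]setD0; exact: FC.
  by rewrite setTI.
rewrite setTD; apply/seteqP; split => [w /= wt|w /= /negP].
  by apply/negP; rewrite -leNgt.
by rewrite -leNgt.
Qed.

(** * The renewal-type identity for [E[N(t)]] *)

(** Pathwise form of the identity on one interval [[x, y)]: the truncated residual starts at
    [min (y - x) v] and loses one unit per unit of time once it is below [v]. *)
Lemma lebesgue_residual_section (R : realType) (x y : \bar R) (t v : R) :
  (0 <= x)%E -> (x <= y)%E -> 0 <= t -> 0 < v -> (x <= t%:E)%E ->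
  (lebesgue_measure [set u : R | (0 <= u <= t)%R &&
      [&& x <= u%:E, u%:E < y & y - u%:E <= v%:E]]
   + (if t%:E < y then mine (y - t%:E) v%:E else 0) =
   maxe (mine (y - x) v%:E) 0)%E.
Proof.
case: x => // x; rewrite !lee_fin => x0 xy t0 v0 xt.
(* If [y] is infinite the residual never falls to [v]: the set is empty and both sides equal [v]. *)
case: y xy => [y| |]// xy; last first.
  rewrite (_ : [set u | _] = set0) ?measure0 ?add0e.
    by rewrite ltry/= addye// (min_idPr _) ?leey// (max_idPl _)// lee_fin ltW.
  rewrite -subset0 => u /= /andP[_ /and3P[_ _]].
  by rewrite addye// leye_eq.
move: xy; rewrite lee_fin lte_fin => xy.
(* The residual reaches [v] at [y - v], so the set starts at [max x (y - v)]. It stops at [t],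
   included, if the interval is still running, and at [y], excluded, otherwise. *)
have [ty|yt] := ltP t y.
  rewrite (_ : [set u | _] = `[Num.max x (y - v), t]%classic).
    rewrite lebesgue_measure_itv/= lte_fin.
    rewrite -!EFinB -!EFin_min -!EFin_max.
    case: ifPn; rewrite ?add0e -?EFinD -?leNgt => h; congr _%:E; move: h.
      by rewrite /Order.max /Order.min; do !case: ifPn; rewrite -?leNgt; lra.
    by rewrite /Order.max /Order.min; do !case: ifPn; rewrite -?leNgt; lra.
  apply/seteqP; split=> u /=; rewrite in_itv/= ?lte_fin ge_max !lee_fin.
    by move=> /and4P[? ? ? ?]; apply/andP; split; lra.
  by move=> /andP[? ?]; apply/and4P; split; lra.
rewrite adde0 (_ : [set u | _] = `[Num.max x (y - v), y[%classic).
  rewrite lebesgue_measure_itv/= lte_fin.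
  rewrite -!EFinB -!EFin_min -!EFin_max.
  case: ifPn; rewrite -?leNgt => h; congr _%:E; move: h.
    by rewrite /Order.max /Order.min; do !case: ifPn; rewrite -?leNgt; lra.
  by rewrite /Order.max /Order.min; do !case: ifPn; rewrite -?leNgt; lra.
apply/seteqP; split=> u /=; rewrite in_itv/= ?lte_fin ge_max !lee_fin.
  by move=> /and4P[? ? ? ?]; apply/andP; split; lra.
by move=> /andP[? ?]; apply/and4P; split; lra.
Qed.

(** Evaluation at a random index is measurable by partitioning according to the value of [k]; here
    the index comes from [N t]. *)
Lemma measurable_fun_select d d' (T : measurableType d) (S : measurableType d')
    (k : T -> nat) (H : nat -> T -> S) :
  measurable_fun [set: T] k -> (forall n, measurable_fun [set: T] (H n)) ->
  measurable_fun [set: T] (fun w => H (k w) w).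
Proof.
move=> mk mH _ B mB; rewrite setTI.
rewrite [X in measurable X](_ : _ = \bigcup_n (k @^-1` [set n] `&` H n @^-1` B)).
  apply: bigcup_measurable => n _; apply: measurableI.
    by rewrite -[X in measurable X]setTI; exact: mk.
  by rewrite -[X in measurable X]setTI; exact: mH.
apply/seteqP; split=> w /=; first by exists (k w).
by move=> [n _ /= [-> ?]].
Qed.

Lemma nneseries_single (R : realType) (f : nat -> \bar R) (k : nat) :
  (0 <= f k)%E -> (forall n, n != k -> f n = 0%E) ->
  (\sum_(0 <= n <oo) f n = f k)%E.
Proof.
move=> fk0 f0; have f_ge0 n : (0 <= f n)%E.
  by have [->//|/f0 ->] := eqVneq n k.
rewrite (nneseriesD1 (n := k))// eseries0 ?adde0// => n _.
by move=> /andP[_ /f0].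
Qed.

(** With [k = N t w] this counts the [n] such that [t_n <= t]. *)
Lemma nneseries_ltn (R : realType) (k : nat) :
  (\sum_(0 <= n <oo) ((n < k)%N%:R : R)%:E = (k%:R : R)%:E)%E.
Proof.
rewrite (nneseries_split _ k) ?add0n; last by move=> n _; rewrite lee_fin.
rewrite eseries0 ?adde0; last first.
  by move=> n kn _; rewrite ltnNge kn.
rewrite sumEFin big_mkord; congr _%:E.
rewrite (eq_bigr (fun=> 1)) => [|i _]; last by rewrite ltn_ord.
by rewrite sumr_const card_ord.
Qed.

Section expected_count.
Context {d : measure_display} {Omega : measurableType d} {R : realType}.
Context (P : probability Omega R) (N : R -> Omega -> nat).
Context (F : R -> set_system Omega) (v : R) (lam : R -> Omega -> R).
Context (C : nat -> Omega -> R).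
Context (hN : counting_process N) (hF : filtration F).
Context (N0 : forall w, N 0 w = 1%N).
Context (Tpos : forall n : nat, (0 < n)%N ->
  {ae P, forall w, (0 < interarrival N n w)%E}).
Context (v0 : 0 < v).
Context (hC : forall n : nat, (0 < n)%N ->
  is_condexp P (sigma_strict_past F (counting_time N n.-1))
    (trunc_interarrival N v n) (C n)).
Context (lamE : forall n t w, (0 < n)%N ->
  (counting_time N n.-1 w <= t%:E)%E -> (t%:E < counting_time N n w)%E ->
  lam t w = (C n w)^-1).

(* Indices are shifted by one: [n] stands for the interval [[t_n, t_(n+1))], on
   which [N = n.+1] and the intensity is [(C n.+1)^-1]. *)
Let tau := counting_time N.
Let c n w : R := Num.max 0 (C n.+1 w)^-1.
Let T_ n w := fine (maxe (trunc_interarrival N v n.+1 w) 0).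
(** The region is taken in the product of time and sample space, so that integrating [f] in either
    order is an instance of Tonelli's theorem. *)
Let S n t := [set z : R * Omega | (0 <= z.1 <= t) &&
  [&& tau n z.2 <= z.1%:E, z.1%:E < tau n.+1 z.2 &
      tau n.+1 z.2 - z.1%:E <= v%:E]%E].
Let f n t (z : R * Omega) : \bar R := (c n z.2 * \1_(S n t) z)%:E.
Let r n t w : R :=
  if N t w == n.+1 then fine (mine (tau n.+1 w - t%:E) v%:E)%E else 0.

Let mtau n : measurable_fun [set: Omega] (tau n).
Proof. exact: measurable_counting_time. Qed.

Let mtrunc n : measurable_fun [set: Omega] (trunc_interarrival N v n.+1).
Proof.
by apply: measurable_mine => //; apply: emeasurable_funB; exact: mtau.
Qed.

Let mC n : measurable_fun [set: Omega] (C n.+1).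
Proof.
have [CG _ _] := @hC n.+1 isT.
move=> _ B mB; rewrite setTI.
by apply: (sigma_strict_past_measurable hF (@mtau n)); exact: CG.
Qed.

Let mc n : measurable_fun [set: Omega] (c n).
Proof.
apply: measurable_maxr => //.
exact: (measurableT_comp (@measurable_invr R)).
Qed.

Let c0 n w : 0 <= c n w. Proof. by rewrite /c le_max lexx. Qed.

Let mS n t : measurable (S n t).
Proof.
rewrite -[X in measurable X]setTI.
apply: (_ : measurable_fun setT (fun z : R * Omega => (0 <= z.1 <= t) &&
  [&& tau n z.2 <= z.1%:E, z.1%:E < tau n.+1 z.2 &
      tau n.+1 z.2 - z.1%:E <= v%:E]%E)) [set true] _ => //.
have m1 : measurable_fun [set: R * Omega] (fun z : R * Omega => z.1%:E).
  exact/measurable_EFinP.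
have m2 k : measurable_fun [set: R * Omega] (fun z : R * Omega => tau k z.2).
  exact: (measurableT_comp (mtau k)).
apply: measurable_and; first apply: measurable_and.
- exact: measurable_fun_ler.
- exact: measurable_fun_ler.
apply: measurable_and; first exact: measurable_fun_lee.
apply: measurable_and; first exact: measurable_fun_lte.
by apply: measurable_fun_lee => //; exact: emeasurable_funB.
Qed.

Let inS n t u w : ((u, w) \in S n t) = (0 <= u <= t) &&
  [&& tau n w <= u%:E, u%:E < tau n.+1 w & tau n.+1 w - u%:E <= v%:E]%E.
Proof. by apply/idP/idP => [/set_mem//|?]; exact: mem_set. Qed.

Let mf n t : measurable_fun [set: R * Omega] (f n t).
Proof.
apply/measurable_EFinP; apply: measurable_funM => //.
exact: (measurableT_comp (@mc n)).
Qed.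

Let f0 n t z : (0 <= f n t z)%E.
Proof. by rewrite lee_fin mulr_ge0. Qed.


Let cond n : is_condexp P (sigma_strict_past F (tau n))
  (trunc_interarrival N v n.+1) (C n.+1).
Proof. exact: (@hC n.+1 isT). Qed.

Let trunc_gt0 n : {ae P, forall w, (0 < trunc_interarrival N v n.+1 w)%E}.
Proof.
by apply: filterS (@Tpos n.+1 isT) => w Tw; rewrite lt_min Tw lte_fin.
Qed.

(** One null set serves all the intervals at once. *)
Let Cpos : {ae P, forall w, forall n, 0 < C n.+1 w}.
Proof.
apply/ae_foralln => n; apply: (condexp_gt0 _ _ (@cond n)) => //.
exact: sigma_strict_past_measurable.
Qed.

Let Npos t w : 0 <= t -> (0 < N t w)%N.
Proof.
by move=> t0; have [mono _ _ _] := hN.2 w; rewrite -(N0 w) mono.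
Qed.

Let tauN t w n : 0 <= t ->
  (N t w == n.+1) = (tau n w <= t%:E)%E && (t%:E < tau n.+1 w)%E.
Proof. by move=> t0; rewrite counting_eq//; exact: hN.2. Qed.

Let lamN t w : 0 <= t -> lam t w = (C (N t w) w)^-1.
Proof.
move=> t0; have := @tauN t w (N t w).-1 t0; rewrite prednK ?Npos// eqxx.
by move=> /esym/andP[? ?]; apply: lamE => //; exact: Npos.
Qed.

Let mNt t : 0 <= t -> measurable_fun [set: Omega] (N t).
Proof. by move=> t0; exact: hN.1. Qed.

Let mlam t : 0 <= t -> measurable_fun [set: Omega] (lam t).
Proof.
(* Since [N t w > 0], the index is unchanged; written as a successor, it only selects versions known
   to be measurable. *)
move=> t0; apply: (eq_measurable_fun (fun w => (C (N t w).-1.+1 w)^-1)).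
  by move=> w _; rewrite lamN// prednK// Npos.
apply: (@measurable_fun_select _ _ _ _ (fun w => (N t w).-1)
  (fun n w => (C n.+1 w)^-1)).
  exact: (measurableT_comp _ (mNt t0)).
by move=> n; exact: (measurableT_comp (@measurable_invr R)).
Qed.

Let resE t w : 0 <= t -> residual N t w = (tau (N t w) w - t%:E)%E.
Proof. by move=> t0; apply: residualE => //; exact: hN.2. Qed.

Let mres t : 0 <= t -> measurable_fun [set: Omega] (residual N t).
Proof.
move=> t0; apply: (eq_measurable_fun (fun w => (tau (N t w) w - t%:E)%E)).
  by move=> w _; rewrite resE.
apply: emeasurable_funB => //.
exact: (measurable_fun_select (mNt t0)).
Qed.

(** At time [u] only the interval with [n.+1 = N u w] contributes, and where all [C] are positive
    the [max] in [c] has no effect. *)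
Let intensity_series t u : 0 <= u <= t ->
  ('E_P[fun w => (lam u w * \1_[set w' | residual N u w' <= v%:E]%E w)%R] =
  \sum_(0 <= n <oo) \int[P]_w f n t (u, w))%E.
Proof.
move=> /andP[u0 ut]; rewrite unlock -integral_nneseries//; last first.
  by move=> n; exact: (measurableT_comp (mf n t)).
apply: ae_eq_integral => //.
- apply/measurable_EFinP; apply: measurable_funM; first exact: mlam.
  apply: measurable_indic; rewrite -[X in measurable X]setTI.
  by apply: emeasurable_fun_infty_c => //; exact: mres.
- apply: ge0_emeasurable_sum => // n _.
  exact: (measurableT_comp (mf n t)).
- apply: filterS Cpos => w Cw _.
  have Nw := Npos w u0.
  (* For [u] in [[0, t]], membership in [S n t] splits into [N u w = n.+1] and a residual of at most
     [v]. *)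
  have fE n : f n t (u, w) =
      if N u w == n.+1 then
        (lam u w * \1_[set w' | residual N u w' <= v%:E]%E w)%:E else 0%E.
    rewrite /f /c !indicE inS u0 ut/= andbA -tauN//.
    case: eqP => [Nn|_]; last by rewrite mulr0.
    rewrite lamN// Nn max_r; last by rewrite invr_ge0 ltW.
    congr (_ * (nat_of_bool _)%:R)%:E.
    rewrite -Nn -resE//.
    by apply/idP/idP => [?|/set_mem//]; exact: mem_set.
  rewrite (nneseries_single (k := (N u w).-1))//.
    by rewrite fE prednK// eqxx.
  move=> n nN; rewrite fE; case: eqP => // Nn.
  by move: nN; rewrite Nn eqxx.
Qed.


Let mF n t : measurable_fun [set: R] (fun u => \int[P]_w f n t (u, w))%E.
Proof. exact: (measurable_fun_fubini_tonelli_F (m2 := P) _ (mf n t) (@f0 n t)). Qed.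

Let mG n t : measurable_fun [set: Omega]
  (fun w => \int[lebesgue_measure]_u f n t (u, w))%E.
Proof.
exact: (measurable_fun_fubini_tonelli_G (m1 := lebesgue_measure) _ (mf n t) (@f0 n t)).
Qed.

Lemma measurable_expected_intensity (t : R) :
  measurable_fun (`[0, t] : set R) (fun u : R =>
    'E_P[fun w => (lam u w * \1_[set w' | residual N u w' <= v%:E]%E w)%R])%E.
Proof.
apply: (eq_measurable_fun (fun u => \sum_(0 <= n <oo) \int[P]_w f n t (u, w))%E).
  by move=> u; rewrite inE/= in_itv/= => ut; apply/esym; exact: intensity_series.
apply: ge0_emeasurable_sum => [n u _ _|n _].
  by apply: integral_ge0 => w _; exact: f0.
exact: measurable_funTS.
Qed.

Lemma expected_intensity_ge0 u : 0 <= u ->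
  (0 <= 'E_P[fun w => (lam u w * \1_[set w' | residual N u w' <= v%:E]%E w)%R])%E.
Proof.
move=> u0; rewrite (@intensity_series u) ?u0 ?lexx//.
by apply: nneseries_ge0 => n _ _; by apply: integral_ge0 => w _; exact: f0.
Qed.

(** All terms are nonnegative, so the time integral may be exchanged first with the series and then
    with the expectation. *)
Let intensity_integral (t : R) : 0 <= t ->
  (\int[lebesgue_measure]_(u in `[0%R, t]) 'E_P[fun w =>
     (lam u w * \1_[set w' | residual N u w' <= v%:E]%E w)%R] =
   \sum_(0 <= n <oo) \int[P]_w \int[lebesgue_measure]_u f n t (u, w))%E.
Proof.
move=> t0.
transitivity (\int[lebesgue_measure]_(u in `[0%R, t])
    \sum_(0 <= n <oo) \int[P]_w f n t (u, w))%E.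
  apply: eq_integral => u; rewrite inE/= in_itv/= => ut.
  exact: intensity_series.
rewrite integral_nneseries//; last 2 first.
- by move=> n; apply: measurable_funTS; exact: mF.
- by move=> n u _; apply: integral_ge0 => w _; exact: f0.
apply: eq_eseriesr => n _; rewrite -fubini_tonelli//; last exact: mf.
(* Integrating over the whole line changes nothing, as [S n t] only has times in [[0, t]]. *)
rewrite integral_mkcond; apply: eq_integral => u _.
rewrite patchE; case: ifPn => // ut; symmetry; apply: integral0_eq => w _.
have -> : f n t (u, w) = (c n w * 0)%:E; last by rewrite mulr0.
rewrite /f indicE inS; congr (_ * _)%:E.
by case: andP => // -[ut']; move: ut; rewrite notin_setE/= in_itv/= ut'.
Qed.

Let mtruncres t : 0 <= t -> measurable_fun [set: Omega] (trunc_residual N v t).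
Proof. by move=> t0; apply: measurable_mine => //; exact: mres. Qed.

Let r_ge0 n t w : 0 <= t -> 0 <= r n t w.
Proof.
move=> t0; rewrite /r; case: eqP => // /eqP; rewrite tauN// => /andP[_ tt].
by rewrite fine_ge0// le_min lee_fin (ltW v0) andbT sube_ge0 ?ltW.
Qed.

Let rE n t w : 0 <= t -> N t w = n.+1 ->
  (r n t w)%:E = trunc_residual N v t w.
Proof.
move=> t0 Nn; rewrite /r Nn eqxx fineK /trunc_residual ?resE ?Nn//.
move/eqP : Nn; rewrite tauN// => /andP[_ tt].
rewrite ge0_fin_numE.
  by rewrite gt_min ltry orbT.
by rewrite le_min lee_fin (ltW v0) andbT sube_ge0 ?ltW.
Qed.

Let mr n t : 0 <= t -> measurable_fun [set: Omega] (r n t).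
Proof.
move=> t0; apply: measurable_fun_ifT.
- apply: (measurable_fun_bool true).
  rewrite setTI (_ : _ @^-1` _ = N t @^-1` [set n.+1]).
    by rewrite -[X in measurable X]setTI; exact: mNt.
  by apply/seteqP; split=> w /= /eqP.
- apply: measurableT_comp => //; apply: measurable_mine => //.
  exact: emeasurable_funB.
- exact: measurable_cst.
Qed.

(** As for the intensity, [r n t w] vanishes unless [N t w = n.+1], which leaves one term. *)
Let residual_series t : 0 <= t ->
  (\int[P]_w ((lam t w)%:E * trunc_residual N v t w) =
   \sum_(0 <= n <oo) \int[P]_w (c n w * r n t w)%:E)%E.
Proof.
move=> t0; rewrite -integral_nneseries//; last 2 first.
- by move=> n; apply/measurable_EFinP/measurable_funM => //; exact: mr.
- by move=> n w _; rewrite lee_fin mulr_ge0// r_ge0.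
apply: ae_eq_integral => //.
- apply: emeasurable_funM; last exact: mtruncres.
  by apply/measurable_EFinP; exact: mlam.
- apply: ge0_emeasurable_sum => n *.
    by rewrite lee_fin mulr_ge0// r_ge0.
  by apply/measurable_EFinP/measurable_funM => //; exact: mr.
- apply: filterS Cpos => w Cw _.
  have Nw := Npos w t0.
  rewrite (nneseries_single (k := (N t w).-1)).
  + rewrite EFinM rE ?prednK// /c max_r ?invr_ge0 ?(ltW (Cw _))//.
    by rewrite prednK// lamN.
  + by rewrite lee_fin mulr_ge0// r_ge0.
  + move=> n nN; rewrite /r; case: eqP => [Nn|_]; last by rewrite mulr0.
    by move: nN; rewrite Nn eqxx.
Qed.


Let section_integral n t w :
  (\int[lebesgue_measure]_u f n t (u, w) =
   (c n w)%:E * lebesgue_measure [set u : R | (0 <= u <= t)%R &&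
     [&& tau n w <= u%:E, u%:E < tau n.+1 w & tau n.+1 w - u%:E <= v%:E]])%E.
Proof.
have -> : [set u : R | (0 <= u <= t)%R && [&& tau n w <= u%:E,
    u%:E < tau n.+1 w & tau n.+1 w - u%:E <= v%:E]]%E = ysection (S n t) w.
  by apply/seteqP; split=> u; rewrite /ysection/= inS.
have mSw : measurable (ysection (S n t) w).
  by apply: measurable_ysection; exact: mS.
transitivity (\int[lebesgue_measure]_u
    ((c n w)%:E * (\1_(ysection (S n t) w) u)%:E))%E.
  apply: eq_integral => u _; rewrite /f EFinM; congr (_ * _)%E.
  by rewrite !indicE mem_ysection.
rewrite ge0_integralZl_EFin//; last first.
  by apply/measurable_EFinP; exact: measurable_indic.
by rewrite integral_indic// setIT.
Qed.

(** If the interval has begun, this is [lebesgue_residual_section] multiplied by [c n w]; otherwise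
    both sides are 0. *)
Let section_residual n t w : 0 <= t ->
  (\int[lebesgue_measure]_u f n t (u, w) + (c n w * r n t w)%:E =
   ((fun w => (c n w * T_ n w)%:E) \_ [set w | tau n w <= t%:E]) w)%E.
Proof.
move=> t0; rewrite section_integral patchE; case: ifPn => [/set_mem/= tt|].
  rewrite !EFinM -ge0_muleDr ?lee_fin ?r_ge0//; congr (_ * _)%E.
  rewrite /T_ fineK; last first.
    rewrite ge0_fin_numE ?le_max ?lexx ?orbT// gt_max ltry andbT.
    by rewrite gt_min ltry orbT.
  rewrite -(@lebesgue_residual_section _ _ (tau n.+1 w) t)//; last 2 first.
  - exact: counting_time_ge0.
  - exact: counting_time_leS.
  congr (_ + _)%E; case: ifPn => tt1; last first.
    by rewrite /r tauN// tt (negbTE tt1).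
  have Nn : N t w = n.+1 by apply/eqP; rewrite tauN// tt tt1.
  by rewrite rE// /trunc_residual resE// Nn.
rewrite notin_setE/= => /negP; rewrite -ltNge => tt.
rewrite (_ : [set u | _] = set0) ?measure0 ?mule0 ?add0e.
  by rewrite /r tauN// leNgt tt/= mulr0.
rewrite -subset0 => u /= /andP[/andP[_ ut] /andP[tu _]].
by move: tt; rewrite ltNge (le_trans tu)// lee_fin.
Qed.

(** By [section_residual] the left side is the expectation of [c n * T_ n] on [t_n <= t]. That event
    lies in the strict past of [t_n], so [condexp_inv] yields its probability. *)
Let expected_step n t : 0 <= t ->
  (\int[P]_w \int[lebesgue_measure]_u f n t (u, w) +
   \int[P]_w (c n w * r n t w)%:E = \int[P]_w ((n < N t w)%N%:R : R)%:E)%E.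
Proof.
move=> t0; rewrite -ge0_integralD//; last 3 first.
- by move=> w _; apply: integral_ge0 => u _; exact: f0.
- by move=> w _; rewrite lee_fin mulr_ge0// r_ge0.
- by apply/measurable_EFinP/measurable_funM => //; exact: mr.
under eq_integral => w _ do rewrite section_residual//.
rewrite -integral_mkcond.
have Gm := sigma_strict_past_measurable hF (mtau n).
have GA : sigma_strict_past F (tau n) [set w | (tau n w <= t%:E)%E].
  exact: sigma_strict_past_le.
rewrite (condexp_inv Gm (@sigma_strict_past_setI _ _ _ _) (mtrunc n) (v := v)
  _ (cond n) (trunc_gt0 n) GA); last first.
  by move=> w; rewrite ge_min lexx orbT.
rewrite -[in LHS](setIT [set w | _]) -integral_indic//; last exact: Gm.
apply: eq_integral => w _; rewrite indicE; congr (nat_of_bool _)%:R%:E.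
rewrite -(@counting_time_le _ _ N w n t)//; last exact: hN.2.
by apply/idP/idP => [/set_mem//|?]; exact: mem_set.
Qed.

(** Summing [expected_step] over [n] gives the expected number of [n] with [n < N t w].
    Nonnegativity makes this valid in the extended reals. *)
Lemma expected_count_decomposition t : 0 <= t ->
  (\int[lebesgue_measure]_(u in `[0%R, t]) 'E_P[fun w =>
     (lam u w * \1_[set w' | residual N u w' <= v%:E]%E w)%R] +
   \int[P]_w ((lam t w)%:E * trunc_residual N v t w) =
   'E_P[fun w => (N t w)%:R])%E.
Proof.
move=> t0; rewrite intensity_integral// residual_series// -nneseriesD; last 2 first.
- move=> n _ _; apply: integral_ge0 => w _; apply: integral_ge0 => u _.
  exact: f0.
- by move=> n _ _; apply: integral_ge0 => w _; rewrite lee_fin mulr_ge0// r_ge0.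
under eq_eseriesr => n _ do rewrite expected_step//.
rewrite -integral_nneseries//; last first.
  move=> n; apply/measurable_EFinP.
  have mlt : measurable_fun [set: nat] (fun k => (n < k)%N%:R : R) by [].
  exact: (measurableT_comp mlt (mNt t0)).
rewrite [in RHS]unlock; apply: eq_integral => w _; exact: nneseries_ltn.
Qed.

Lemma trunc_residual_intensity_ge0 t : 0 <= t ->
  (0 <= \int[P]_w ((lam t w)%:E * trunc_residual N v t w))%E.
Proof.
move=> t0; rewrite residual_series//; apply: nneseries_ge0 => n _ _.
by apply: integral_ge0 => w _; rewrite lee_fin mulr_ge0// r_ge0.
Qed.

End expected_count.

(** * Asymptotics *)

Lemma cvg_pinftyP (R : realType) (g : R -> R) (l : R) :
  g t @[t --> +oo] --> l <->
  forall e, 0 < e -> exists2 M, 0 <= M & forall t, M <= t -> `|l - g t| < e.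
Proof.
split=> [/(@cvgrPdist_lt _ R^o) gl e e0|gl].
  have [M [_ HM]] := gl e e0.
  (* Adding 1 turns the strict threshold of the filter at infinity into a non-strict one. *)
  exists (Num.max 0 (M + 1)); first by rewrite le_max lexx.
  move=> t; rewrite ge_max => /andP[_ Mt]; apply: HM.
  by rewrite (lt_le_trans _ Mt)// ltrDl.
apply/(@cvgrPdist_lt _ R^o) => e e0; have [M _ HM] := gl e e0.
exists M; split; first exact: num_real.
by move=> t /ltW; exact: HM.
Qed.

(** The increments of [m] are those of [i], of slope close to [alpha], plus those of [b], which tend
    to 0. *)
Lemma cvg_of_asymptotic_slope (R : realType) (i b m : R -> R) (alpha beta : R) :
  (forall e, 0 < e -> exists2 M, 0 <= M & forall s t, M <= s -> s <= t ->
     `|i t - i s - alpha * (t - s)| <= e * (t - s)) ->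
  b t @[t --> +oo] --> beta ->
  (forall t, 0 <= t -> m t = i t + b t) ->
  m t * t^-1 @[t --> +oo] --> alpha /\
  forall h, 0 < h -> m (t + h) - m t @[t --> +oo] --> alpha * h.
Proof.
move=> slope /cvg_pinftyP bl mE; split=> [|h h0]; apply/cvg_pinftyP => e e0.
  have e2 : 0 < e / 2 by rewrite divr_gt0.
  have [M M0 HM] := slope _ e2; have [L L0 HL] := bl _ ltr01.
  (* [K] bounds what does not grow in [m t - alpha * t]: the deviation of [i] at [M], and [b t],
     within 1 of [beta]. *)
  pose K := `|i M - alpha * M| + `|beta| + 1.
  have K0 : 0 < K by rewrite ltr_wpDl// addr_ge0.
  (* Past [2 * K / e] the constant [K] is below [e / 2 * t]; the slope error supplies the other half
     of [e * t]. *)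
  exists (M + L + 2 * K / e + 1).
    by rewrite !addr_ge0// divr_ge0 ?mulr_ge0 ?ltW.
  move=> t; set q := 2 * K / e => tge.
  have q0 : 0 <= q by rewrite divr_ge0 ?mulr_ge0 ?ltW.
  have Kq : K = q * e / 2 by rewrite /q; field; rewrite gt_eqF.
  have t0 : 0 < t by lra.
  have Mt : M <= t by lra.
  have Lt : L <= t by lra.
  have := HM M t (lexx _) Mt; have := HL t Lt => h1 h2.
  have -> : alpha - m t * t^-1 = (alpha * t - m t) / t.
    by field; rewrite gt_eqF.
  rewrite normrM normfV (gtr0_norm t0) ltr_pdivrMr//.
  rewrite mE ?(ltW t0)//.
  have qt : e / 2 * q < e / 2 * t by rewrite ltr_pM2l//; lra.
  have Me : 0 <= e / 2 * M by rewrite mulr_ge0// ltW.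
  move: h1 h2 Kq; rewrite /K !ltr_norml !ler_norml => /andP[? ?] /andP[? ?].
  have := ler_norm (i M - alpha * M); have := ler_norm (- (i M - alpha * M)).
  rewrite normrN; have := ler_norm beta; have := ler_norm (- beta).
  rewrite normrN => *; apply/andP; split; lra.
have e4 : 0 < e / 4 by rewrite divr_gt0.
(* Slope error [e / 4 / h] over length [h] costs [e / 4], and each of the two values of [b] costs
   another [e / 4]. *)
have [M M0 HM] := slope _ (divr_gt0 e4 h0); have [L L0 HL] := bl _ e4.
exists (M + L); first by rewrite addr_ge0.
move=> t tge.
have Mt : M <= t by lra.
have Lt : L <= t by lra.
have t0 : 0 <= t by lra.
have th : t <= t + h by lra.
have := HM t (t + h) Mt th; rewrite (addrC t h) addrK -(addrC t) mulfVK ?gt_eqF//.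
have := HL t Lt; have := HL (t + h) (le_trans Lt th).
rewrite !mE//; last exact: le_trans th.
rewrite !ltr_norml !ler_norml => /andP[? ?] /andP[? ?] /andP[? ?].
by apply/andP; split; lra.
Qed.

(** Past some [M] the integrand is finite and within [e] of [alpha]; integrating these bounds over
    []s, t]] gives the claim. *)
Lemma integral_asymptotic_slope (R : realType) (a : R -> \bar R) (alpha : R) :
  (forall t, measurable_fun (`[0, t] : set R) a) ->
  (forall t, 0 <= t -> (0 <= a t)%E) ->
  (forall t, 0 <= t ->
     (\int[lebesgue_measure]_(u in `[0%R, t]) a u)%E \is a fin_num) ->
  a t @[t --> +oo] --> alpha%:E ->
  let i t := fine (\int[lebesgue_measure]_(u in `[0%R, t]) a u)%E in
  forall e, 0 < e -> exists2 M, 0 <= M & forall s t, M <= s -> s <= t ->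
     `|i t - i s - alpha * (t - s)| <= e * (t - s).
Proof.
move=> ma a0 afin /fine_cvgP[[M0 [_ HM0]]] /cvg_pinftyP al i e e0.
have [M1 M10 HM1] := al e e0.
exists (Num.max M1 (M0 + 1)); first by rewrite le_max M10.
move=> s t; rewrite ge_max => /andP[M1s M0s] st.
have s0 : 0 <= s := le_trans M10 M1s.
have t0 : 0 <= t := le_trans s0 st.
have au u : u \in `]s, t] -> a u \is a fin_num /\ `|alpha - fine (a u)| < e.
  rewrite in_itv/= => /andP[su _]; split.
    by apply: HM0; apply: lt_trans su; rewrite (lt_le_trans _ M0s)// ltrDl.
  by apply: HM1; rewrite (le_trans M1s)// ltW.
have aI u : u \in `]s, t] -> (0 <= a u)%E.
  by rewrite in_itv/= => /andP[su _]; rewrite a0// (le_trans s0)// ltW.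
have itvU : `[0, t]%classic = `[0, s]%classic `|` `]s, t]%classic :> set R.
  by apply: itv_bndbnd_setU; rewrite bnd_simp.
have mast : measurable_fun (`]s, t] : set R) a.
  by apply: measurable_funS (ma t) => //; rewrite itvU; exact: subsetUr.
have D : (\int[lebesgue_measure]_(u in `[0%R, t]) a u =
   \int[lebesgue_measure]_(u in `[0%R, s]) a u +
   \int[lebesgue_measure]_(u in `]s, t]) a u)%E.
  rewrite itvU ge0_integral_setU//.
  - by rewrite -itvU; exact: ma.
  - move=> u [|]; last exact: aI.
    by rewrite /= in_itv/= => /andP[u0 _]; exact: a0.
  - apply/disj_setPLR => u /=; rewrite !in_itv/= => /andP[_ us].
    by rewrite ltNge us.
have cst_int r : (\int[lebesgue_measure]_(u in `]s, t]) r%:E = (r * (t - s))%:E)%E.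
  rewrite integral_cst//= lebesgue_measure_itv/= lte_fin.
  move: st; rewrite le_eqVlt => /predU1P[->|->//].
  by rewrite ltxx subrr mule0 mulr0.
have lo : (((alpha - e) * (t - s))%:E <=
    \int[lebesgue_measure]_(u in `]s, t]) a u)%E.
  (* Since [alpha - e] may be negative, it is first raised to 0 to compare integrals of nonnegative
     functions; [a] stays above it. *)
  apply: (@le_trans _ _ (Num.max 0 (alpha - e) * (t - s))%:E).
    by rewrite lee_fin ler_wpM2r ?subr_ge0// le_max lexx orbT.
  rewrite -cst_int; apply: ge0_le_integral => //.
    by move=> u _; rewrite lee_fin le_max lexx.
  move=> u ust; have [au1 au2] := au u ust.
  rewrite -(fineK au1) lee_fin ge_max fine_ge0 ?aI//=.
  by move: au2; rewrite ltr_norml => /andP[? ?]; lra.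
have hi : (\int[lebesgue_measure]_(u in `]s, t]) a u <= ((alpha + e) * (t - s))%:E)%E.
  rewrite -cst_int; apply: ge0_le_integral => //.
  move=> u ust; have [au1 au2] := au u ust.
  rewrite -(fineK au1) lee_fin.
  by move: au2; rewrite ltr_norml => /andP[? ?]; lra.
have Jfin : (\int[lebesgue_measure]_(u in `]s, t]) a u)%E \is a fin_num.
  rewrite ge0_fin_numE; first exact: le_lt_trans hi (ltry _).
  by apply: integral_ge0 => u; exact: aI.
rewrite /i D fineD ?afin// [X in X - fine _]addrC addrK.
move: lo hi; rewrite -(fineK Jfin) !lee_fin ler_norml => lo hi.
by apply/andP; split; lra.
Qed.

Theorem theorem5p1 (d : measure_display) (Omega : measurableType d)
    (R : realType) (P : probability Omega R)
    (N : R -> Omega -> nat) (F : R -> set_system Omega)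
    (hN : counting_process N)
    (hF : filtration F)
    (hXF : forall t : R, 0 <= t -> natural_sigma (counting_state N) t `<=` F t)
    (hX0 : forall w, counting_state N 0 w = (1%N, interarrival N 1 w))
    (hTpos : forall n : nat, (0 < n)%N ->
       {ae P, forall w, (0 < interarrival N n w)%E})
    (hTint : forall n : nat, (0 < n)%N ->
       (\int[P]_w interarrival N n w < +oo)%E)
    (hNint : forall t : R, 0 <= t -> ('E_P[fun w => (N t w)%:R] < +oo)%E)
    (hlim : exists v : R, 0 < v /\
       exists lam : R -> Omega -> R,
         is_trunc_intensity P F N v lam /\
         (exists a : R, 0 < a /\
            ('E_P[fun w => (lam t w * \1_[set w' | residual N t w' <= v%:E]%E w)%R])%E
              @[t --> +oo] --> a%:E) /\
         (exists b : R, 0 < b /\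
            (\int[P]_w ((lam t w)%:E * trunc_residual N v t w))%E
              @[t --> +oo] --> b%:E)) :
  exists lambda : R, 0 < lambda /\
    ('E_P[fun w => (N t w)%:R] * (t^-1)%:E)%E @[t --> +oo] --> lambda%:E /\
    (forall h : R, 0 < h ->
       ('E_P[fun w => (N (t + h)%R w)%:R] - 'E_P[fun w => (N t w)%:R])%E
         @[t --> +oo] --> (lambda * h)%:E).
Proof.
have [v [v0 [lam [[C [hC lamE]] [[alpha [alpha0 cvga]] [beta [_ cvgb]]]]]]] := hlim.
have N0 w : N 0 w = 1%N by have := hX0 w; case.
pose a u := ('E_P[fun w =>
  (lam u w * \1_[set w' | residual N u w' <= v%:E]%E w)%R])%E.
pose b t := (\int[P]_w ((lam t w)%:E * trunc_residual N v t w))%E.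
pose E t := ('E_P[fun w => (N t w)%:R])%E.
have ma t : measurable_fun (`[0, t] : set R) a.
  exact: (measurable_expected_intensity hN hF N0 hTpos v0 hC lamE).
have a0 t : 0 <= t -> (0 <= a t)%E.
  exact: (expected_intensity_ge0 hN hF N0 hTpos v0 hC lamE).
have b0 t : 0 <= t -> (0 <= b t)%E.
  exact: (trunc_residual_intensity_ge0 hN hF N0 hTpos v0 hC lamE).
have EE t : 0 <= t ->
    (\int[lebesgue_measure]_(u in `[0%R, t]) a u + b t = E t)%E.
  exact: (expected_count_decomposition hN hF N0 hTpos v0 hC lamE).
have I0 t : (0 <= \int[lebesgue_measure]_(u in `[0%R, t]) a u)%E.
  apply: integral_ge0 => u /=; rewrite in_itv/= => /andP[u0 _]; exact: a0.
(* Finiteness of [E t] passes to both summands of the decomposition, which then becomes an identity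
   between reals. *)
have Efin t : 0 <= t -> E t \is a fin_num.
  by move=> t0; rewrite ge0_fin_numE ?hNint// -EE// adde_ge0// b0.
have Ifin t : 0 <= t ->
    (\int[lebesgue_measure]_(u in `[0%R, t]) a u)%E \is a fin_num.
  by move=> t0; have := Efin t t0; rewrite -EE// fin_numD => /andP[].
have bfin t : 0 <= t -> b t \is a fin_num.
  by move=> t0; have := Efin t t0; rewrite -EE// fin_numD => /andP[].
have slope := integral_asymptotic_slope ma a0 Ifin cvga.
have cvgb' : fine (b t) @[t --> +oo] --> beta by exact: fine_cvg cvgb.
have mE t : 0 <= t -> fine (E t) =
    fine (\int[lebesgue_measure]_(u in `[0%R, t]) a u)%E + fine (b t).
  by move=> t0; rewrite -EE// fineD ?Ifin ?bfin.
have [rate incr] := cvg_of_asymptotic_slope slope cvgb' mE.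
(* The rate is the limit of the intensity term; the residual term only adds a convergent
   quantity. *)
exists alpha; split => //; split=> [|h h0].
  have H : (fine (E t) * t^-1)%:E @[t --> +oo] --> alpha%:E.
    by apply: cvg_EFin rate; exact: nearW.
  apply: cvg_trans H.
  (* [E t] is known to be finite for [t >= 0], hence eventually, which suffices for the limit. *)
  apply: near_eq_cvg; near=> t; rewrite /= EFinM fineK//; apply: Efin.
  by near: t; exact: nbhs_pinfty_ge.
have H : (fine (E (t + h)) - fine (E t))%:E @[t --> +oo]
    --> (alpha * h)%:E.
  by apply: cvg_EFin (incr h h0); exact: nearW.
apply: cvg_trans H.
apply: near_eq_cvg; near=> t.
have t0 : 0 <= t by near: t; exact: nbhs_pinfty_ge.
by rewrite /= EFinB !fineK ?Efin// addr_ge0// ltW.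
Unshelve. all: by end_near.
Qed.
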